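(* Let $X$ be an infinite dimensional complex Banach space and let $T\in L(X)$. If there exists an integer $n\in\mathbb N$ such that $\mathcal R(T^n)$ is closed and $T_{[n]}$ is semi-Fredholm, then for each $m\ge n$, $\mathcal R(T^m)$ is closed, $T_{[m]}$ is semi-Fredholm and $\mathrm{ind}(T_{[m]})=\mathrm{ind}(T_{[n]})$.
   Context: $L(X)$ is the algebra of bounded linear operators on $X$; $\mathbb N$ includes $0$. For a bounded operator $S$ on a normed space $Y$ (a Banach space in the relevant cases), with kernel $\mathcal N(S)$ and range $\mathcal R(S)$: $S$ is upper semi-Fredholm if $\mathcal R(S)$ is closed and $\dim\mathcal N(S)<\infty$; lower semi-Fredholm if $\mathrm{codim}\,\mathcal R(S)<\infty$; semi-Fredholm if it is upper or lower semi-Fredholm, and then $\mathrm{ind}(S)=\dim\mathcal N(S)-\mathrm{codim}\,\mathcal R(S)\in\mathbb Z\cup\{\pm\infty\}$. For $n\in\mathbb N$, $T_{[n]}:\mathcal R(T^n)\to\mathcal R(T^n)$ is the restriction of $T$ to $\mathcal R(T^n)$, viewed as a map from $\mathcal R(T^n)$ into $\mathcal R(T^n)$ (in particular $T_{[0]}=T$). *)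

(* Defs.v *)
From HB Require Import structures.
From mathcomp Require Import all_boot all_order all_algebra.
From mathcomp Require Import complex.
From mathcomp Require Import all_classical all_reals all_analysis.
Import Order.TTheory GRing.Theory Num.Theory.
Import numFieldNormedType.Exports.

Set Implicit Arguments.
Unset Strict Implicit.
Unset Printing Implicit Defensive.

Local Open Scope classical_set_scope.
Local Open Scope ring_scope.

(* For subspaces [M `<=` A], the classes of the [e i] form a basis of the
   quotient space [A / M]; with [M = [set 0]], [e] is a basis of [A]. *)
Definition basis_mod (K : fieldType) (V : lmodType K) (A M : set V) (n : nat)
    (e : 'I_n -> V) : Prop :=
  [/\ forall i, A (e i),
      forall c : 'I_n -> K, M (\sum_i c i *: e i) -> forall i, c i = 0
    & forall x, A x -> exists c : 'I_n -> K, M (x - \sum_i c i *: e i)].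

(* The size of a basis of [A / M] is unique, so the choice made by [cid] does
   not matter. *)
Definition dim_mod (K : fieldType) (V : lmodType K) (A M : set V) : \bar int :=
  if pselect (exists n, exists e : 'I_n -> V, basis_mod A M e) is left fin
  then (projT1 (cid fin))%:Z%:E else +oo%E.

Definition lin_dim (K : fieldType) (V : lmodType K) (A : set V) : \bar int :=
  dim_mod A [set 0].

Definition lin_codim (K : fieldType) (V : lmodType K) (A : set V) : \bar int :=
  dim_mod [set: V] A.

Section SemiFredholm.
Variables (K : numFieldType) (Y : normedModType K).

Definition bounded_operator (S : {linear Y -> Y}) : Prop :=
  exists M : K, forall x, `|S x| <= M * `|x|.

Definition null_space (S : {linear Y -> Y}) : set Y := [set x | S x = 0].

Definition upper_semi_Fredholm (S : {linear Y -> Y}) : Prop :=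
  closed (range S) /\ (lin_dim (null_space S) < +oo)%E.

Definition lower_semi_Fredholm (S : {linear Y -> Y}) : Prop :=
  (lin_codim (range S) < +oo)%E.

Definition semi_Fredholm (S : {linear Y -> Y}) : Prop :=
  upper_semi_Fredholm S \/ lower_semi_Fredholm S.

(* Only meaningful when [S] is semi-Fredholm: then at most one of the two terms
   is [+oo]. *)
Definition fredholm_index (S : {linear Y -> Y}) : \bar int :=
  (lin_dim (null_space S) - lin_codim (range S))%E.

End SemiFredholm.

Section Range.
Variables (K : numFieldType) (U V : normedModType K) (f : {linear U -> V}).

Definition range_pred : {pred V} := mem (range f).

Lemma range_pred_submod_closed : submod_closed range_pred.
Proof.
split; first by apply/mem_set; exists 0 => //; rewrite linear0.
move=> a _ _ /set_mem[x _ <-] /set_mem[y _ <-].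
by apply/mem_set; exists (a *: x + y) => //; rewrite linearP.
Qed.

HB.instance Definition _ :=
  GRing.isSubmodClosed.Build K V range_pred range_pred_submod_closed.

Record range_type := RangeType {
  range_val :> V;
  range_valP : range_val \in range_pred }.

HB.instance Definition _ := [isSub for range_val].
HB.instance Definition _ := [Choice of range_type by <:].
HB.instance Definition _ := [SubChoice_isSubLmodule of range_type by <:].

Definition range_norm (x : range_type) : K := `|val x|.

Lemma range_normD x y : range_norm (x + y) <= range_norm x + range_norm y.
Proof. by rewrite /range_norm raddfD; exact: ler_normD. Qed.

Lemma range_normZ (a : K) x : range_norm (a *: x) = `|a| * range_norm x.
Proof. by rewrite /range_norm linearZ normrZ. Qed.

Lemma range_norm_eq0 x : range_norm x = 0 -> x = 0.
Proof.
by move=> /normr0_eq0 x0; apply: val_inj; rewrite x0 raddf0.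
Qed.

HB.instance Definition _ := Lmodule_isNormed.Build K range_type
  range_normD range_normZ range_norm_eq0.

End Range.

Section Restriction.
Variables (K : numFieldType) (X : normedModType K) (T : {linear X -> X}).

Definition op_power (n : nat) : X -> X := iter n T.

Lemma op_power_is_linear n : linear (op_power n).
Proof.
move=> a x y; elim: n => [//|n IHn].
by rewrite /op_power !iterS -!/(op_power n _) IHn linearP.
Qed.

HB.instance Definition _ n :=
  GRing.isLinear.Build K X X *:%R (op_power n) (op_power_is_linear n).

Lemma op_power_range_stable n x :
  x \in range_pred (op_power n) -> T x \in range_pred (op_power n).
Proof.
move=> /set_mem[y _ <-]; apply/mem_set; exists (T y) => //.
by rewrite /op_power -[RHS]iterS iterSr.
Qed.

Definition restriction n (x : range_type (op_power n)) : range_type (op_power n) :=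
  RangeType (op_power_range_stable (range_valP x)).

Lemma restriction_is_linear n : linear (@restriction n).
Proof.
by move=> a x y; apply: val_inj; rewrite /= !linearP.
Qed.

HB.instance Definition _ n := GRing.isLinear.Build K (range_type (op_power n))
  (range_type (op_power n)) *:%R (@restriction n) (@restriction_is_linear n).

End Restriction.

Arguments restriction {K X} T n.

(* Main.v *)
Require Import Defs.
From mathcomp Require Import all_boot all_order all_algebra.
From mathcomp Require Import complex zify ring lra.
From mathcomp Require Import all_classical all_reals all_analysis.
Import Order.TTheory GRing.Theory Num.Theory.
Import numFieldNormedType.Exports.

Set Implicit Arguments.
Unset Strict Implicit.
Unset Printing Implicit Defensive.

Local Open Scope classical_set_scope.
Local Open Scope ring_scope.

(** Write [M = R(T^m)], [M' = T M = R(T^m.+1)], [M'' = T M'] and [N = ker T].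
    By induction it suffices to pass from [m] to [m + 1]; the restriction of [T]
    to [M] has kernel [M `&` N] and range [M'].

    The algebra is in [dim_restriction_shift]. The map that [T] induces from
    [M / M'] onto [M' / M''] has kernel [(M' + (M `&` N)) / M'], which is
    isomorphic to [(M `&` N) / (M' `&` N)]. With [d] the dimension of this last
    space, passing from [m] to [m + 1] therefore removes the same [d] from the
    dimension of the kernel and from the codimension of the range. As one of
    these two is finite, so is [d], and the index does not change.

    The analysis shows that ranges stay closed. If [M / M'] is finite
    dimensional then [M'] is closed ([closed_image_finite_codim]). If [M'] is
    closed and [M `&` N] is finite dimensional then [M' + (M `&` N)] is closed
    ([closed_add_span]) and contains the kernel of [T] on [M], so that its image
    [M''] is closed as well ([closed_image_sub]). The two lemmas on
    images rest on an open mapping theorem for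
    [(x, c) |-> T x + \sum_i c i *: e i], whose finitely many extra scalar
    variables [c] avoid any quotient or product space. It is deduced from
    Baire's theorem through a form of Zabreiko's lemma ([zabreiko]): a family of
    balls that is closed under fast convergent series and covers a complete
    subspace absorbs the unit ball of that subspace.

    Since only sequences with geometric rate of convergence occur, the norm is
    used through its real part [rnorm], and closedness and completeness through
    [closed_approx] and [geom_cvg]. *)

(** * Linear subspaces *)

Definition is_subspace {K : fieldType} {V : lmodType K} (A : set V) : Prop :=
  A 0 /\ forall (a : K) x y, A x -> A y -> A (a *: x + y).

Section Subspace.
Context {K : fieldType} {V : lmodType K}.
Implicit Types (A B : set V).

Lemma subspace_add A x y : is_subspace A -> A x -> A y -> A (x + y).
Proof. by move=> [_ sA] Ax Ay; rewrite -[x]scale1r; exact: sA. Qed.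

Lemma subspace_scale A a x : is_subspace A -> A x -> A (a *: x).
Proof. by move=> [A0 sA] Ax; rewrite -[_ *: _]addr0; exact: sA. Qed.

Lemma subspace_opp A x : is_subspace A -> A x -> A (- x).
Proof. by move=> sA Ax; rewrite -scaleN1r; exact: subspace_scale. Qed.

Lemma subspace_sub A x y : is_subspace A -> A x -> A y -> A (x - y).
Proof. by move=> sA Ax Ay; apply: subspace_add => //; exact: subspace_opp. Qed.

Lemma subspace_sum A n (c : 'I_n -> K) (e : 'I_n -> V) :
  is_subspace A -> (forall i, A (e i)) -> A (\sum_i c i *: e i).
Proof.
move=> sA Ae; elim/big_ind: _ => [|x y Ax Ay|i _]; first by case: sA.
- exact: subspace_add.
- exact: subspace_scale.
Qed.

Lemma subspace_trivial : is_subspace [set 0 : V].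
Proof. by split=> // a x y -> ->; rewrite scaler0 addr0. Qed.

Lemma subspaceI A B : is_subspace A -> is_subspace B -> is_subspace (A `&` B).
Proof.
move=> [A0 sA] [B0 sB]; split=> // a x y [Ax Bx] [Ay By].
by split; [exact: sA|exact: sB].
Qed.

Lemma subspace_preimage {W : lmodType K} (f : {linear V -> W}) (M : set W) :
  is_subspace M -> is_subspace (f @^-1` M).
Proof.
move=> [M0 sM]; split; first by rewrite /preimage /= linear0.
by move=> a x y Mx My; rewrite /preimage /= linearP; exact: sM.
Qed.

Lemma subspace_image {W : lmodType K} (f : {linear V -> W}) A :
  is_subspace A -> is_subspace (f @` A).
Proof.
move=> [A0 sA]; split; first by exists 0 => //; rewrite linear0.
move=> a _ _ [x Ax <-] [y Ay <-].
by exists (a *: x + y); [exact: sA|rewrite linearP].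
Qed.

End Subspace.

Lemma is_subspace_add_line {K : fieldType} {X : lmodType K} (F : set X)
    (e : X) : is_subspace F ->
  is_subspace [set y | exists c : K, F (y - c *: e)].
Proof.
move=> [F0 sF]; split; first by exists 0; rewrite scale0r subr0.
move=> a x y [c Fx] [d Fy]; exists (a * c + d).
have := sF a _ _ Fx Fy.
by rewrite scalerDl -scalerA scalerBr addrACA -opprD.
Qed.

Lemma is_subspace_add_span {K : fieldType} {X : lmodType K} (F : set X) k
    (e : 'I_k -> X) : is_subspace F ->
  is_subspace [set y | exists c : 'I_k -> K, F (y - \sum_i c i *: e i)].
Proof.
move=> [F0 sF]; split.
  by exists (fun=> 0); rewrite big1 ?subr0 // => i _; rewrite scale0r.
move=> a x y [c Fx] [d Fy]; exists (fun i => a * c i + d i).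
have := sF a _ _ Fx Fy.
rewrite scalerBr scaler_sumr addrACA -opprD -big_split /=; congr (F (_ - _)).
by apply: eq_bigr => i _; rewrite scalerDl scalerA.
Qed.

(** * Dimension of a quotient *)

Section Dimension.
Context {K : fieldType} {V : lmodType K}.
Implicit Types (A B M : set V).

Definition free_mod M n (e : 'I_n -> V) : Prop :=
  forall c : 'I_n -> K, M (\sum_i c i *: e i) -> forall i, c i = 0.

Definition spans_mod A M n (e : 'I_n -> V) : Prop :=
  forall x, A x -> exists c : 'I_n -> K, M (x - \sum_i c i *: e i).

(** Steinitz: modulo [M] the [e i] are combinations of the [e' j], with a
    coefficient matrix whose rows are dependent when [m < n]; a dependence
    between the rows is one between the [e i]. *)
Lemma free_mod_leq A M n m (e : 'I_n -> V) (e' : 'I_m -> V) :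
  is_subspace M -> (forall i, A (e i)) -> free_mod M e -> spans_mod A M e' ->
  (n <= m)%N.
Proof.
move=> sM Ae fe se'.
have /choice[B HB] : forall i, exists c : 'I_m -> K, M (e i - \sum_j c j *: e' j).
  by move=> i; exact: se'.
pose BM : 'M[K]_(n, m) := \matrix_(i, j) B i j.
rewrite leqNgt; apply/negP => ltmn.
have /rowV0Pn[v /sub_kermxP vB v0] : kermx BM != 0.
  rewrite kermx_eq0 /row_free; apply/negP => /eqP rk.
  by move: (rank_leq_col BM); rewrite rk leqNgt ltmn.
have Mv : M (\sum_i v 0 i *: e i).
  have vBe : \sum_i v 0 i *: (\sum_j B i j *: e' j) = 0.
    under eq_bigr do rewrite scaler_sumr.
    rewrite exchange_big /= big1 // => j _.
    have /matrixP/(_ 0 j) := vB; rewrite !mxE => vBj.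
    transitivity ((\sum_i v 0 i * BM i j) *: e' j); last by rewrite vBj scale0r.
    by rewrite scaler_suml; apply: eq_bigr => i _; rewrite mxE scalerA.
  have -> : \sum_i v 0 i *: e i =
      \sum_i v 0 i *: (e i - \sum_j B i j *: e' j).
    under [RHS]eq_bigr do rewrite scalerBr.
    by rewrite sumrB vBe subr0.
  by apply: (subspace_sum (e := fun i => e i - \sum_j B i j *: e' j) _ sM).
move/eqP: v0; apply; apply/rowP => i; rewrite mxE.
exact: (fe (fun i => v 0 i) Mv).
Qed.

Lemma dim_mod_basis A M n (e : 'I_n -> V) :
  is_subspace M -> basis_mod A M e -> dim_mod A M = n%:Z%:E.
Proof.
move=> sM [Ae fe se]; rewrite /dim_mod; case: pselect => [fin|]; last first.
  by case; exists n, e.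
case: (cid fin) => m /= [e' [Ae' fe' se']].
by congr (_%:Z%:E); apply/eqP; rewrite eqn_leq;
  apply/andP; split; [exact: (free_mod_leq sM Ae' fe' se)|exact: (free_mod_leq sM Ae fe se')].
Qed.

Lemma dim_mod_infinite A M :
  ~ (exists n (e : 'I_n -> V), basis_mod A M e) -> dim_mod A M = +oo%E.
Proof. by rewrite /dim_mod; case: pselect. Qed.

Lemma dim_mod_finP A M :
  (dim_mod A M < +oo)%E <-> exists n (e : 'I_n -> V), basis_mod A M e.
Proof.
rewrite /dim_mod; case: pselect => [fin|nfin]; last by rewrite ltxx.
by rewrite ltry.
Qed.

Lemma dim_modP A M : is_subspace M ->
  (exists n (e : 'I_n -> V), basis_mod A M e /\ dim_mod A M = n%:Z%:E) \/
  (~ (exists n (e : 'I_n -> V), basis_mod A M e) /\ dim_mod A M = +oo%E).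
Proof.
move=> sM; have [[n [e be]]|nfin] := pselect (exists n (e : 'I_n -> V), basis_mod A M e).
- by left; exists n, e; split=> //; exact: dim_mod_basis be.
- by right; split=> //; exact: dim_mod_infinite.
Qed.

(** A free family of maximal size is a basis: otherwise a vector outside its
    span could be added to it. *)
Lemma basis_mod_exists A M N : is_subspace M ->
  (forall n (e : 'I_n -> V), (forall i, A (e i)) -> free_mod M e ->
    (n <= N)%N) ->
  exists n (e : 'I_n -> V), basis_mod A M e.
Proof.
move=> sM bnd.
pose P n := `[< exists e : 'I_n -> V, (forall i, A (e i)) /\ free_mod M e >].
have P0 : exists n, P n.
  exists 0%N; apply/asboolP; exists (fun=> 0); split=> [[]//|c _ []//].
have PN n : P n -> (n <= N)%N by move/asboolP => [e [Ae fe]]; exact: bnd fe.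
case: (ex_maxnP P0 PN) => n /asboolP[e [Ae fe]] nmax.
exists n, e; split=> // x Ax.
apply: contrapT => nx.
have : P n.+1; last by move/nmax; rewrite ltnn.
apply/asboolP.
(* [x] in position 0, followed by the family [e] *)
exists (fun i => if unlift ord0 i is Some j then e j else x); split.
  by move=> i; case: unliftP => [j|] _.
move=> c; rewrite big_ord_recl unlift_none.
under eq_bigr do rewrite liftK.
move=> Mc; have [c0|c0] := eqVneq (c ord0) 0.
  move: Mc; rewrite c0 scale0r add0r => /fe cz i.
  by case: (unliftP ord0 i) => [j|] ->.
case: nx; exists (fun j => - (c ord0)^-1 * c (lift ord0 j)).
have := subspace_scale (c ord0)^-1 sM Mc.
rewrite scalerDr scalerA mulVf // scale1r scaler_sumr; congr (M (_ + _)).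
rewrite -sumrN; apply: eq_bigr => j _.
by rewrite scalerA mulNr scaleNr opprK.
Qed.

Lemma basis_mod_cat A B M n m (e : 'I_n -> V) (f : 'I_m -> V) :
  is_subspace A -> is_subspace B -> M `<=` B -> B `<=` A ->
  basis_mod B M e -> basis_mod A B f ->
  exists g : 'I_(n + m) -> V, basis_mod A M g.
Proof.
move=> sA sB MB BA [Be fe se] [Af ff sf].
exists (fun i => match fintype.split i with inl j => e j | inr j => f j end).
have sumE (c : 'I_(n + m) -> K) :
    \sum_i c i *: (match fintype.split i with inl j => e j | inr j => f j end) =
    \sum_j c (lshift m j) *: e j + \sum_j c (rshift n j) *: f j.
  rewrite big_split_ord /=; congr (_ + _); apply: eq_bigr => j _.
  - by rewrite (unsplitK (inl j : 'I_n + 'I_m)).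
  - by rewrite (unsplitK (inr j : 'I_n + 'I_m)).
split.
- by move=> i; case: fintype.split => j //; exact/BA.
- move=> c; rewrite sumE => Mc.
  have Bs : B (\sum_j c (lshift m j) *: e j) by exact: subspace_sum.
  have cf : forall j, c (rshift n j) = 0.
    apply: ff; have := subspace_sub sB (MB _ Mc) Bs.
    by rewrite addrAC subrr add0r.
  move: Mc; rewrite [X in _ + X]big1 ?addr0 => [/fe ce|j _]; last first.
    by rewrite cf scale0r.
  by move=> i; case: (split_ordP i) => j ->; [exact: ce|exact: cf].
- move=> x Ax; have [d Bd] := sf x Ax; have [c Mc] := se _ Bd.
  exists (fun i => match fintype.split i with inl j => c j | inr j => d j end).
  rewrite sumE; move: Mc; congr (M _).
  rewrite opprD addrA [RHS]addrAC; congr (_ - _ - _); apply: eq_bigr => j _.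
  - by rewrite (unsplitK (inr j : 'I_n + 'I_m)).
  - by rewrite (unsplitK (inl j : 'I_n + 'I_m)).
Qed.

(** Infinite values are included: a finite basis of [A / M] bounds the size of
    the families that are free in [B / M] or in [A / B]. *)
Lemma dim_mod_add A B M : is_subspace A -> is_subspace B -> is_subspace M ->
  M `<=` B -> B `<=` A ->
  dim_mod A M = (dim_mod A B + dim_mod B M)%E.
Proof.
move=> sA sB sM MB BA.
have [[m [f [bf ->]]]|[nAB ->]] := dim_modP A sB.
  have [[n [e [be ->]]]|[nBM ->]] := dim_modP B sM.
    have [g bg] := basis_mod_cat sA sB MB BA be bf.
    by rewrite (dim_mod_basis sM bg) PoszD addrC.
  rewrite dim_mod_infinite // => -[N [g [Ag fg sg]]]; apply: nBM.
  apply: (basis_mod_exists (N := N)) => // n e Be fe.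
  by apply: (@free_mod_leq A M _ _ e g) => // i; exact/BA.
have -> : dim_mod A M = +oo%E.
  rewrite dim_mod_infinite // => -[N [g [Ag fg sg]]]; apply: nAB.
  apply: (basis_mod_exists (N := N)) => // n e Ae fe.
  by apply: (@free_mod_leq A M _ _ e g) => // c /MB; exact: fe.
by have [[n [e [be ->]]]|[nBM ->]] := dim_modP B sM.
Qed.

End Dimension.

Section Transport.
Context {K : fieldType} {V W : lmodType K}.

(** The first isomorphism theorem, in the form
    [f A / (f A `&` M) = A / (A `&` f^-1 M)]; it also transports dimensions along
    the inclusion of a subspace. *)
Lemma dim_mod_image (f : {linear V -> W}) (A : set V) (M : set W) :
  is_subspace A -> is_subspace M -> dim_mod (f @` A) M = dim_mod A (f @^-1` M).
Proof.
move=> sA sM.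
have fsum n (c : 'I_n -> K) (e : 'I_n -> V) :
    \sum_i c i *: f (e i) = f (\sum_i c i *: e i).
  by rewrite linear_sum; apply: eq_bigr => i _; rewrite linearZ.
have [[n [e [[Ae fe se] ->]]]|[nfin ->]] :=
    dim_modP A (subspace_preimage f sM).
  apply: (@dim_mod_basis _ _ _ _ _ (f \o e) sM); split.
  - by move=> i; exists (e i).
  - by move=> c; rewrite /= fsum => /fe.
  - by move=> _ [x Ax <-]; have [c Mc] := se x Ax; exists c; rewrite /= fsum -linearB.
rewrite dim_mod_infinite // => -[n [g [Ag fg sg]]]; apply: nfin.
have /choice[e He] : forall i, exists x, A x /\ f x = g i.
  by move=> i; have [x Ax <-] := Ag i; exists x.
exists n, e; split.
- by move=> i; have [] := He i.
- move=> c; rewrite /preimage /= -fsum => Mc; apply: fg; move: Mc.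
  by congr (M _); apply: eq_bigr => i _; rewrite (He i).2.
- move=> x Ax; have [c Mc] := sg (f x) (imageP f Ax); exists c.
  rewrite /preimage /= linearB -fsum; move: Mc.
  by congr (M (_ - _)); apply: eq_bigr => i _; rewrite (He i).2.
Qed.

End Transport.

Lemma dim_mod_setI {K : fieldType} {V : lmodType K} (A M : set V) :
  is_subspace A -> is_subspace M -> dim_mod A (A `&` M) = dim_mod A M.
Proof.
move=> sA sM; have sAM := subspaceI sA sM.
have E n (e : 'I_n -> V) : basis_mod A (A `&` M) e <-> basis_mod A M e.
  split=> -[Ae fe se]; split=> //.
  - by move=> c Mc; apply: fe; split=> //; exact: subspace_sum.
  - by move=> x /se[c [_ Mc]]; exists c.
  - by move=> c [_ Mc]; exact: fe.
  - move=> x Ax; have [c Mc] := se x Ax; exists c; split=> //.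
    by apply: subspace_sub => //; exact: subspace_sum.
have [[n [e [be ->]]]|[nfin ->]] := dim_modP A sAM.
  by rewrite (dim_mod_basis sM ((E _ _).1 be)).
by rewrite dim_mod_infinite // => -[n [e /E be]]; apply: nfin; exists n, e.
Qed.

Lemma dim_mod_ge0 {K : fieldType} {V : lmodType K} (A M : set V) :
  (0 <= dim_mod A M)%E.
Proof. by rewrite /dim_mod; case: pselect => *; rewrite ?leey ?lee_fin. Qed.

(** The second isomorphism theorem: [B / M] and [A / (A `&` M)] agree when
    [B = A + (B `&` M)]. *)
Lemma dim_mod_congr {K : fieldType} {V : lmodType K} (A B M : set V) :
  is_subspace M -> A `<=` B ->
  (forall x, B x -> exists2 y, A y & M (x - y)) ->
  dim_mod B M = dim_mod A M.
Proof.
move=> sM AB BA.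
have [[n [e [[Ae fe se] ->]]]|[nfin ->]] := dim_modP A sM.
  apply: (dim_mod_basis (e := e) sM); split=> //; first by move=> i; exact/AB.
  move=> x /BA[y Ay Mxy]; have [c Mc] := se y Ay; exists c.
  by have := subspace_add sM Mxy Mc; rewrite addrA subrK.
rewrite dim_mod_infinite // => -[N [g [Bg fg sg]]]; apply: nfin.
apply: (basis_mod_exists (N := N)) => // n e Ae fe.
by apply: (@free_mod_leq _ _ B M _ _ e g) => // i; exact/AB.
Qed.

(** Here [d] is the dimension of [(M `&` ker) / (T M `&` ker)]. It enters
    [dim M / T M] through the intermediate space [Q = T M + (M `&` ker)], for
    which [M / Q] is isomorphic to [T M / T (T M)]. *)
Lemma dim_restriction_shift {K : fieldType} {V : lmodType K}
    (T : {linear V -> V}) (M : set V) (ker := T @^-1` [set 0]) :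
  is_subspace M -> T @` M `<=` M ->
  exists2 d : \bar int, (0 <= d)%E &
    dim_mod (M `&` ker) [set 0] = (d + dim_mod (T @` M `&` ker) [set 0%R])%E /\
    dim_mod M (T @` M) = (dim_mod (T @` M) (T @` (T @` M)) + d)%E.
Proof.
move=> sM TM; have sTM := subspace_image T sM; have sTTM := subspace_image T sTM.
have sker : is_subspace ker := subspace_preimage T subspace_trivial.
have sN : is_subspace (M `&` ker) := subspaceI sM sker.
exists (dim_mod (M `&` ker) (T @` M)); first exact: dim_mod_ge0.
split.
  have E : M `&` ker `&` T @` M = T @` M `&` ker.
    by rewrite setIAC; congr (_ `&` _); rewrite setIC; exact/setIidPl.
  rewrite (@dim_mod_add _ _ _ (T @` M `&` ker)) //.
  - by rewrite -E dim_mod_setI.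
  - exact: subspaceI.
  - exact: subspace_trivial.
  - by move=> _ ->; split; [case: sTM|case: sker].
  - exact: setSI.
pose Q := M `&` T @^-1` (T @` (T @` M)).
have sQ : is_subspace Q by apply: subspaceI => //; exact: subspace_preimage.
rewrite (@dim_mod_add _ _ _ Q) //; last 2 first.
- by move=> x TMx; split; [exact: TM|exact: imageP].
- exact: subIsetl.
congr (_ + _)%E.
  rewrite dim_mod_setI ?dim_mod_image //; exact: subspace_preimage.
apply: dim_mod_congr => //.
- move=> x [Mx kx]; split=> //; rewrite /preimage /= kx.
  by case: sTTM.
- move=> x [Mx [y TMy Txy]]; exists (x - y); last by rewrite subKr.
  split; first by apply: subspace_sub => //; exact: TM.
  by rewrite /ker /preimage /= linearB Txy subrr.
Qed.

(** * The norm as a real number, closed sets and geometric convergence *)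

Section RealNorm.
Context {R : realType} {V : normedModType R[i]}.
Implicit Types x y : V.

(** The norm of a complex normed space takes values in [R[i]], where the order is
    only partial; it is real, and [rnorm] is its value in [R]. *)
Definition rnorm (x : V) : R := complex.Re `|x|.

Lemma rnormE x : `|x| = (rnorm x)%:C%C.
Proof.
rewrite /rnorm; have /ger0_real := normr_ge0 x.
by case: `|x| => a b /complex_realP[c [-> ->]].
Qed.

Lemma rnorm_ge0 x : 0 <= rnorm x.
Proof. by rewrite -lecR -rnormE; exact: normr_ge0. Qed.

Lemma rnormD x y : rnorm (x + y) <= rnorm x + rnorm y.
Proof. by rewrite -lecR rmorphD /= -!rnormE; exact: ler_normD. Qed.

Lemma rnormN x : rnorm (- x) = rnorm x.
Proof. by rewrite /rnorm normrN. Qed.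

Lemma rnormB x y : rnorm (x - y) = rnorm (y - x).
Proof. by rewrite -rnormN opprB. Qed.

Lemma rnorm0 : rnorm 0 = 0.
Proof. by rewrite /rnorm normr0. Qed.

Lemma rnorm_triangle x y z : rnorm (x - z) <= rnorm (x - y) + rnorm (y - z).
Proof. by have := rnormD (x - y) (y - z); rewrite addrA subrK. Qed.

Lemma rnorm_small_eq x y : (forall e, 0 < e -> rnorm (x - y) < e) -> x = y.
Proof.
move=> xy; apply/eqP; rewrite -subr_eq0 -normr_eq0 rnormE.
have : rnorm (x - y) <= 0.
  by rewrite leNgt; apply/negP => /xy; rewrite ltxx.
by rewrite le_eqVlt ltNge rnorm_ge0 orbF => /eqP ->.
Qed.

End RealNorm.

Lemma rnorm_sum {R : realType} {V : normedModType R[i]} n (f : 'I_n -> V) :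
  rnorm (\sum_i f i) <= \sum_i rnorm (f i).
Proof.
elim/big_ind2: _ => [|x a y b xa yb|//]; first by rewrite rnorm0.
by rewrite (le_trans (rnormD _ _)) // lerD.
Qed.

Lemma rnormZ {R : realType} {V : normedModType R[i]} (a : R[i]) (x : V) :
  rnorm (a *: x) = @rnorm R R[i]^o a * rnorm x.
Proof.
apply: complexI; rewrite rmorphM /= -!rnormE; exact: normrZ.
Qed.

Lemma rnorm_real {R : realType} (a : R) : @rnorm R R[i]^o (a%:C%C) = `|a|.
Proof.
by rewrite /rnorm normc_def /= expr0n /= addr0 sqrtr_sqr.
Qed.

Lemma posC_real {R : rcfType} (e : R[i]) :
  0 < e -> exists2 r : R, 0 < r & e = r%:C%C.
Proof.
move=> e0; have /ger0_real := ltW e0.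
case: e e0 => a b e0 /complex_realP[c ec].
by exists c; rewrite ec in e0 *; first by rewrite -ltcR.
Qed.

Lemma closed_approx {R : realType} {V : normedModType R[i]} (A : set V) :
  closed A <->
  forall y, (forall e : R, 0 < e -> exists2 a, A a & rnorm (y - a) < e) -> A y.
Proof.
split=> [cA y Hy|H].
  apply: cA => B /nbhs_ballP[e /= /posC_real[r r0 ->] eB].
  have [a Aa ya] := Hy r r0; exists a; split=> //; apply: eB.
  by rewrite -ball_normE /ball_ /= rnormE ltcR.
move=> y /= cy; apply: H => e e0.
have e0C : 0 < e%:C%C by rewrite ltcR.
have [a [Aa]] := cy (ball y e%:C%C) (nbhsx_ballx y e%:C%C e0C).
by rewrite -ball_normE /ball_ /= rnormE ltcR => ya; exists a.
Qed.

Arguments closed_approx {R V} A.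

Lemma geometric_small {R : realType} (r e : R) :
  0 < e -> exists n, r * 2^-1 ^+ n < e.
Proof.
move=> e0; have : r * 2^-1 ^+ n @[n --> \oo] --> r * 0.
  by apply: cvgMl_tmp; apply: cvg_expr; rewrite ger0_norm; lra.
rewrite mulr0 => /cvgrPdist_lt/(_ e e0)[n _ /(_ n (leqnn n))] /=.
rewrite sub0r normrN => /(le_lt_trans (ler_norm _)).
by exists n.
Qed.

Definition cauchy_complete {R : realType} (V : normedModType R[i]) : Prop :=
  forall F : set_system V, ProperFilter F -> cauchy F -> cvg F.

(** The form in which completeness is used: steps of size at most [r / 2 ^ n]
    give a limit, with the tail of the geometric series as explicit error. *)
Lemma geom_cvg {R : realType} {V : normedModType R[i]} (u : nat -> V) (r : R) :
  cauchy_complete V ->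
  (forall n, rnorm (u n.+1 - u n) <= r * 2^-1 ^+ n) ->
  exists l, forall n, rnorm (l - u n) <= 2 * r * 2^-1 ^+ n.
Proof.
move=> cV ur.
have r0 : 0 <= r by have := ur 0%N; rewrite expr0 mulr1; apply: le_trans; exact: rnorm_ge0.
have tail n k : rnorm (u (n + k)%N - u n) <= 2 * r * 2^-1 ^+ n * (1 - 2^-1 ^+ k).
  elim: k => [|k IH]; first by rewrite expr0 addn0 !subrr rnorm0 mulr0.
  rewrite (le_trans (rnorm_triangle _ (u (n + k)%N) _)) // addnS.
  rewrite (le_trans (lerD (ur _) IH)) // exprD exprS.
  by move: (2^-1 ^+ n) (2^-1 ^+ k) => a b; lra.
have cu : cauchy (u @ \oo).
  apply: cauchy_exP => e /posC_real[d d0 ->].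
  have [n nd] := geometric_small (2 * r) d0.
  exists (u n); exists n => //= m nm.
  rewrite -ball_normE /ball_ /= rnormE ltcR rnormB -(subnKC nm).
  rewrite (le_lt_trans (tail _ _)) // (le_lt_trans _ nd) //.
  by rewrite ler_piMr ?mulr_ge0 ?exprn_ge0 ?invr_ge0 // gerBl exprn_ge0 ?invr_ge0.
have /cvg_ex [l ul] : cvg (u @ \oo) by exact: cV.
exists l => n; apply/ler_addgt0Pl => e e0.
have e0C : 0 < e%:C%C by rewrite ltcR.
have [m _ /(_ (n + m)%N (leq_addl _ _))] := (cvgrPdist_lt _ _).1 ul _ e0C.
rewrite /= rnormE ltcR => /ltW lum.
rewrite (le_trans (rnorm_triangle _ (u (n + m)%N) _)) // lerD //.
rewrite (le_trans (tail _ _)) //.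
by rewrite ler_piMr ?mulr_ge0 ?exprn_ge0 ?invr_ge0 // gerBl exprn_ge0 ?invr_ge0.
Qed.

Lemma geom_series {R : realType} {V : normedModType R[i]} (u : nat -> V) (r : R) :
  cauchy_complete V -> (forall k, rnorm (u k) <= r * 2^-1 ^+ k) ->
  exists l, forall n, rnorm (l - \sum_(k < n) u k) <= 2 * r * 2^-1 ^+ n.
Proof.
move=> cV ur; apply: geom_cvg => // n.
by rewrite big_ord_recr /= addrAC subrr add0r.
Qed.

Lemma rnorm_complex {R : realType} (z : R[i]) :
  @rnorm R R[i]^o z = Num.sqrt (complex.Re z ^+ 2 + complex.Im z ^+ 2).
Proof. by rewrite /rnorm normc_def. Qed.

(** Real and imaginary parts are 1-Lipschitz, so they map Cauchy filters to
    Cauchy filters of [R]. *)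
Lemma C_complete (R : realType) : @cauchy_complete R R[i]^o.
Proof.
move=> F PF /cauchy_ballP cF.
have near e : 0 < e -> \forall x & y \near F, @rnorm R R[i]^o (x - y) < e.
  move=> e0; have e0C : 0 < e%:C%C by rewrite ltcR.
  have [[A B] [FA FB] AB] := cF _ e0C.
  exists (A, B) => //= -[x y] /= [Ax By]; have /= := AB (x, y) (conj Ax By).
  by rewrite -ball_normE /ball_ /= rnormE ltcR.
have cpart (f : R[i] -> R) : {morph f : x y / x - y} ->
    (forall x, `|f x| <= @rnorm R R[i]^o x) -> exists l : R, f @ F --> l.
  move=> fB fle; apply/cvg_ex; apply: R_complete.
  apply/cauchy_ballP => e e0; have [[A B] [FA FB] AB] := near e e0.
  exists (f @` A, f @` B) => /=.
    by split; [apply: filterS FA|apply: filterS FB] => z Az; exists z.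
  move=> [_ _] /= [[x Ax <-] [y By <-]].
  rewrite /ball /= -fB (le_lt_trans (fle _)) //.
  exact: (AB (x, y)).
have [|z|a Fa] := cpart (@complex.Re R); first by move=> [? ?] [? ?].
  rewrite rnorm_complex -sqrtr_sqr ler_wsqrtr // lerDl; exact: sqr_ge0.
have [|z|b Fb] := cpart (@complex.Im R); first by move=> [? ?] [? ?].
  rewrite rnorm_complex -sqrtr_sqr ler_wsqrtr // lerDr; exact: sqr_ge0.
apply/cvg_ex; exists (Complex a b); apply/cvgrPdist_lt => e /posC_real[r r0 ->].
have r2 : 0 < r / 2 by lra.
move/cvgrPdist_lt/(_ _ r2) : Fa; move/cvgrPdist_lt/(_ _ r2) : Fb.
apply: filterS2 => -[c d] /= bd ac.
rewrite rnormE ltcR rnorm_complex /=.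
have -> : r = `|r| by rewrite gtr0_norm.
rewrite -sqrtr_sqr ltr_sqrt ?exprn_gt0 //.
rewrite -(@real_normK _ (a - c)) ?num_real // -(@real_normK _ (b - d)) ?num_real //.
have := normr_ge0 (a - c); have := normr_ge0 (b - d).
by move: `|a - c| `|b - d| ac bd => p q; nra.
Qed.

(** * Baire category and Zabreiko's lemma *)

Section Zabreiko.
Context {R : realType} {X : normedModType R[i]}.
Hypothesis cX : cauchy_complete X.
Variables (Y : set X).
Hypotheses (sY : is_subspace Y) (cY : closed Y).

(** Baire's theorem for a countable cover of the closed subspace [Y]: some member
    is dense in a ball of [Y]. Otherwise one finds nested balls of [Y], the
    [n]-th step avoiding [B n], whose radii are at least halved at each step;
    their common point would lie in no [B n]. *)
Lemma baire_covering (B : nat -> set X) :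
  (forall y, Y y -> exists n, B n y) ->
  exists n y0 (rho : R), [/\ Y y0, 0 < rho &
    forall y, Y y -> rnorm (y - y0) < rho ->
      forall e, 0 < e -> exists2 b, B n b & rnorm (y - b) < e].
Proof.
move=> Bcov; apply: contrapT => nex.
have step (np : nat * (X * R)) : exists q : X * R, Y np.2.1 -> 0 < np.2.2 ->
    [/\ Y q.1, 0 < q.2, q.2 <= np.2.2 / 2, rnorm (q.1 - np.2.1) <= np.2.2 / 2 &
      forall l, rnorm (l - q.1) <= q.2 -> ~ B np.1 l].
  case: np => n [y0 rho] /=.
  have [Yy0|] := pselect (Y y0); last by exists (0, 0).
  have [rho0|] := pselect (0 < rho); last by exists (0, 0).
  have rho2 : 0 < rho / 2 by lra.
  suff [y [Yy yy0 [e e0 He]]] : exists y, [/\ Y y, rnorm (y - y0) < rho / 2 &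
      exists2 e, 0 < e & forall b, B n b -> e <= rnorm (y - b)].
    exists (y, Num.min (rho / 2) (e / 2)) => _ _ /=; split=> //.
    - by rewrite lt_min rho2 /=; lra.
    - by rewrite ge_min lexx.
    - exact: ltW.
    - move=> l; rewrite le_min => /andP[_ le2] /He.
      by rewrite rnormB => /le_trans/(_ le2); lra.
  apply: contrapT => ny; apply: nex; exists n, y0, (rho / 2); split=> //.
  move=> y Yy yy0 e e0; apply: contrapT => nb; apply: ny; exists y; split=> //.
  exists e => // b Bb; rewrite leNgt; apply/negP => be.
  by apply: nb; exists b.
have [f Hf] := choice step.
(* the centre and the radius of the successive balls *)
pose fix u n : X * R := if n is p.+1 then f (p, u p) else (0, 1).
have inv n : Y (u n).1 /\ 0 < (u n).2.
  elim: n => [|n [Yu u0]] /=; first by split; [case: sY|exact: ltr01].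
  by have [] := Hf (n, u n) Yu u0.
have Hu n : [/\ (u n.+1).2 <= (u n).2 / 2,
    rnorm ((u n.+1).1 - (u n).1) <= (u n).2 / 2 &
    forall l, rnorm (l - (u n.+1).1) <= (u n.+1).2 -> ~ B n l].
  by have [Yu u0] := inv n; have [] := Hf (n, u n) Yu u0.
have rad n : (u n).2 <= 2^-1 ^+ n.
  elim: n => [|n IH]; first by rewrite expr0.
  by have [h _ _] := Hu n; rewrite exprS; lra.
have [l Hl] : exists l, forall n, rnorm (l - (u n).1) <= 2 * 1 * 2^-1 ^+ n.
  apply: geom_cvg => // n; have [_ h _] := Hu n.
  by have := rad n; have [_ ?] := inv n; lra.
have far n k : rnorm ((u (n + k)%N).1 - (u n).1) <= (u n).2 - (u (n + k)%N).2.
  elim: k => [|k IH]; first by rewrite addn0 !subrr rnorm0.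
  rewrite addnS; have [h1 h2 _] := Hu (n + k)%N.
  by have := rnorm_triangle (u (n + k).+1).1 (u (n + k)%N).1 (u n).1; lra.
have lu n : rnorm (l - (u n).1) <= (u n).2.
  apply/ler_addgt0Pl => e e0.
  have [k ke] := geometric_small 2 e0.
  have := rnorm_triangle l (u (n + k)%N).1 (u n).1.
  have := far n k; have [_ up] := inv (n + k)%N; have := Hl (n + k)%N.
  have : 2^-1 ^+ (n + k) <= 2^-1 ^+ k :> R.
    by rewrite exprD ler_piMl ?exprn_ge0 ?exprn_ile1 //; lra.
  by lra.
have Yl : Y l.
  apply: (closed_approx Y).1 => // e e0; have [n ne] := geometric_small 2 e0.
  by exists (u n).1; [exact: (inv n).1|rewrite (le_lt_trans (Hl n)) // mulr1].
have [n Bl] := Bcov l Yl.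
by have [_ _ /(_ l (lu n.+1))] := Hu n.
Qed.

(** Think of [B r] as the image of a ball of radius [r] under a map from a Banach
    space onto [Y]; [Bseries] is what completeness of the source provides. *)
Variable B : R -> set X.
Hypotheses
  (BY : forall r, B r `<=` Y)
  (BZ : forall (a r : R) x, 0 < a -> B r x -> B (a * r) (a%:C%C *: x))
  (BN : forall r x, B r x -> B r (- x))
  (BD : forall r s x y, B r x -> B s y -> B (r + s) (x + y))
  (Bcov : forall y, Y y -> exists n, B n%:R y)
  (Bseries : forall (r s : R) (b : nat -> X) y, 0 <= r ->
    (forall k, B (r * 2^-1 ^+ k) (b k)) ->
    (forall n, rnorm (y - \sum_(k < n) b k) <= s * 2^-1 ^+ n) -> B (2 * r) y).

(** By Baire some [B n] is dense in a ball of [Y]; differences and scaling then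
    give approximations in [B (C * t)], up to an error [t / 2], of all vectors of
    [Y] of norm at most [t]. Approximating the error in turn, again and again,
    writes the vector as a series to which [Bseries] applies. *)
Lemma zabreiko : exists2 C : R, 0 <= C &
  forall y t, Y y -> 0 < t -> rnorm y <= t -> B (C * t) y.
Proof.
have [n [y0 [rho [Yy0 rho0 Bd]]]] := baire_covering Bcov.
pose C : R := 4 * n%:R / rho.
have C0 : 0 <= C by rewrite divr_ge0 ?mulr_ge0 ?ler0n // ltW.
have approx (p : R * X) : exists b : X, 0 < p.1 -> Y p.2 -> rnorm p.2 <= p.1 ->
    B (C * p.1) b /\ rnorm (p.2 - b) <= p.1 / 2.
  case: p => t y /=.
  have [t0|] := pselect (0 < t); last by exists 0.
  have [Yy|] := pselect (Y y); last by exists 0.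
  have [yt|] := pselect (rnorm y <= t); last by exists 0.
  (* [s] scales [y] to norm at most [rho / 2], so that [y0 + s *: y] stays in the
     ball of centre [y0] and radius [rho] *)
  pose s : R := rho / (2 * t).
  have s0 : 0 < s by rewrite divr_gt0 // mulr_gt0.
  have sC0 : s%:C%C != 0 by rewrite eq_complex /= negb_and gt_eqF.
  have e0 : 0 < rho / 8 by lra.
  have Y1 : Y (y0 + s%:C%C *: y).
    by apply: subspace_add => //; exact: subspace_scale.
  have near1 : rnorm (y0 + s%:C%C *: y - y0) < rho.
    rewrite addrAC subrr add0r rnormZ rnorm_real gtr0_norm //.
    rewrite (@le_lt_trans _ _ (s * t)) //; first by rewrite ler_pM2l.
    have -> : s * t = rho / 2 by rewrite /s; field; rewrite gt_eqF.
    by lra.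
  have [b1 B1 h1] := Bd _ Y1 near1 _ e0.
  have [|b2 B2 h2] := Bd y0 Yy0 _ _ e0; first by rewrite subrr rnorm0.
  exists ((s^-1)%:C%C *: (b1 - b2)) => _ _ _; split.
    have -> : C * t = s^-1 * (n%:R + n%:R).
      by rewrite /C /s; field; rewrite !gt_eqF.
    by apply: BZ; [rewrite invr_gt0|apply: BD => //; exact: BN].
  have -> : y - (s^-1)%:C%C *: (b1 - b2) =
      (s^-1)%:C%C *: ((y0 + s%:C%C *: y - b1) - (y0 - b2)).
    have -> : y0 + s%:C%C *: y - b1 - (y0 - b2) = s%:C%C *: y - (b1 - b2).
      rewrite [y0 + _]addrC -!addrA; congr (_ + _).
      by rewrite !opprB addrA [y0 - b1]addrC addrACA subrr addr0 addrC.
    rewrite [RHS]scalerBr scalerA -rmorphM /= mulVf ?gt_eqF // scale1r //.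
  rewrite rnormZ rnorm_real gtr0_norm ?invr_gt0 //.
  have := rnormD (y0 + s%:C%C *: y - b1) (- (y0 - b2)); rewrite rnormN => h3.
  rewrite ler_pdivrMl //.
  have -> : s * (t / 2) = rho / 4 by rewrite /s; field; rewrite gt_eqF.
  by lra.
have [g Hg] := choice approx.
exists (2 * C) => [|y t Yy t0 yt]; first by rewrite mulr_ge0.
(* the error left after [k] approximations *)
pose fix v k := if k is p.+1 then v p - g (t * 2^-1 ^+ p, v p) else y.
have tk k : 0 < t * 2^-1 ^+ k by rewrite mulr_gt0 // exprn_gt0 // invr_gt0.
have Hv k : Y (v k) /\ rnorm (v k) <= t * 2^-1 ^+ k.
  elim: k => [|k [Yv vk]]; first by rewrite expr0 mulr1.
  have [Bg gk] := Hg (t * 2^-1 ^+ k, v k) (tk k) Yv vk.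
  split; first by apply: subspace_sub => //; exact: BY Bg.
  by move: gk => /=; rewrite exprS; lra.
rewrite -mulrA; apply: (Bseries (s := t) (b := fun k => g (t * 2^-1 ^+ k, v k))).
- by rewrite mulr_ge0 // ltW.
- move=> k; have [Yv vk] := Hv k.
  by have [Bg _] := Hg (t * 2^-1 ^+ k, v k) (tk k) Yv vk; rewrite -mulrA.
- move=> k; have -> : y - \sum_(j < k) g (t * 2^-1 ^+ j, v j) = v k.
    elim: k => [|k IH]; first by rewrite big_ord0 subr0.
    by rewrite big_ord_recr /= opprD addrA IH.
  by have [] := Hv k.
Qed.

End Zabreiko.

(** * Open mapping and closedness of images *)

Lemma subrACA {V : zmodType} (a b c d : V) : a - b - (c - d) = a - c - (b - d).
Proof. by rewrite !opprB addrACA [RHS]addrACA [- b + _]addrC. Qed.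

Section Operator.
Context {R : realType} {X : normedModType R[i]}.
Hypothesis cX : cauchy_complete X.
Variables (T : {linear X -> X}) (M : R).
Hypotheses (M0 : 0 <= M) (TM : forall x, rnorm (T x) <= M * rnorm x).

(** The open mapping theorem for [(x, c) |-> T x + \sum_i c i *: e i] from
    [F * R[i] ^ k] onto [Y], for the maximum of the norms on the product. *)
Lemma open_mapping (F Y : set X) k (e : 'I_k -> X) :
  is_subspace F -> closed F -> is_subspace Y -> closed Y ->
  T @` F `<=` Y -> (forall i, Y (e i)) ->
  (forall y, Y y -> exists c : 'I_k -> R[i], (T @` F) (y - \sum_i c i *: e i)) ->
  exists2 C : R, 0 <= C & forall y t, Y y -> 0 < t -> rnorm y <= t ->
    exists x (c : 'I_k -> R[i]), [/\ F x, rnorm x <= C * t,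
      forall i, @rnorm R R[i]^o (c i) <= C * t &
      y = T x + \sum_i c i *: e i].
Proof.
move=> sF cF sY cY TF Ye Ysp.
pose B (r : R) : set X := [set y | exists x (c : 'I_k -> R[i]), [/\ F x, rnorm x <= r,
  forall i, @rnorm R R[i]^o (c i) <= r & y = T x + \sum_i c i *: e i]].
have rC0 (z : R[i]) : 0 <= @rnorm R R[i]^o z by exact: rnorm_ge0.
apply: (zabreiko (B := B) cX sY cY).
- move=> r _ [x [c [Fx _ _ ->]]]; apply: subspace_add => //.
    by apply: TF; exists x.
  exact: subspace_sum.
- move=> a r _ a0 [x [c [Fx xr cr ->]]].
  exists (a%:C%C *: x), (fun i => a%:C%C * c i); split.
  + exact: subspace_scale.
  + by rewrite rnormZ rnorm_real gtr0_norm // ler_pM2l.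
  + move=> i; rewrite -[_ * _]/(a%:C%C *: (c i : R[i]^o)) rnormZ rnorm_real.
    by rewrite gtr0_norm // ler_pM2l.
  + rewrite scalerDr linearZ scaler_sumr; congr (_ + _).
    by apply: eq_bigr => i _; rewrite scalerA.
- move=> r _ [x [c [Fx xr cr ->]]].
  exists (- x), (fun i => - c i); split.
  + exact: subspace_opp.
  + by rewrite rnormN.
  + by move=> i; rewrite -[- _]/(- (c i : R[i]^o)) rnormN.
  + rewrite opprD linearN -sumrN; congr (_ + _).
    by apply: eq_bigr => i _; rewrite scaleNr.
- move=> r s _ _ [x [c [Fx xr cr ->]]] [x' [c' [Fx' xr' cr' ->]]].
  exists (x + x'), (fun i => c i + c' i); split.
  + exact: subspace_add.
  + by rewrite (le_trans (rnormD _ _)) // lerD.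
  + move=> i; rewrite (le_trans (@rnormD R R[i]^o (c i) (c' i))) // lerD //.
  + rewrite linearD addrACA -big_split /=; congr (_ + _).
    by apply: eq_bigr => i _; rewrite scalerDl.
- move=> y Yy; have [c [x Fx Tx]] := Ysp y Yy.
  pose S := rnorm x + \sum_i @rnorm R R[i]^o (c i).
  have S0 : 0 <= \sum_i @rnorm R R[i]^o (c i) by exact: sumr_ge0.
  exists (Num.truncn S).+1, x, c.
  have Sn : S <= (Num.truncn S).+1%:R by rewrite ltW // truncnS_gt.
  split => //.
  + by rewrite (le_trans _ Sn) // lerDl.
  + move=> i; rewrite (le_trans _ Sn) // /S (bigD1 i) //= addrCA lerDl.
    by rewrite addr_ge0 ?rnorm_ge0 ?sumr_ge0.
  + by rewrite Tx subrK.
- move=> r s b y r0 Bb yb.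
  have /choice[x Hx] : forall j, exists x, exists c : 'I_k -> R[i],
      [/\ F x, rnorm x <= r * 2^-1 ^+ j,
      forall i, @rnorm R R[i]^o (c i) <= r * 2^-1 ^+ j &
      b j = T x + \sum_i c i *: e i] by move=> j; exact: Bb.
  have {Hx} /choice[c Hc] := Hx.
  have [z Hz] : exists z, forall n,
      rnorm (z - \sum_(j < n) x j) <= 2 * r * 2^-1 ^+ n.
    by apply: geom_series => // j; have [] := Hc j.
  have /choice[d Hd] : forall i, exists d : R[i], forall n,
      @rnorm R R[i]^o (d - \sum_(j < n) c j i) <= 2 * r * 2^-1 ^+ n.
    move=> i; apply: (@geom_series R R[i]^o (fun j => c j i)).
      exact: C_complete.
    by move=> j; have [] := Hc j.
  exists z, d; split.
  + apply: (closed_approx F).1 => // eps eps0.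
    have [n ne] := geometric_small (2 * r) eps0.
    exists (\sum_(j < n) x j); last exact: le_lt_trans (Hz n) ne.
    elim/big_ind: _ => [|u v Fu Fv|j _]; first by case: sF.
      exact: subspace_add.
    by have [] := Hc j.
  + by have := Hz 0%N; rewrite big_ord0 subr0 expr0 mulr1.
  + by move=> i; have := Hd i 0%N; rewrite big_ord0 subr0 expr0 mulr1.
  + apply: rnorm_small_eq => eps eps0.
    pose W := s + M * (2 * r) + \sum_i 2 * r * rnorm (e i).
    have [n ne] := geometric_small W eps0.
    apply: le_lt_trans ne.
    have sumb : \sum_(j < n) b j =
        T (\sum_(j < n) x j) + \sum_i (\sum_(j < n) c j i) *: e i.
      under [X in _ = _ + X]eq_bigr do rewrite scaler_suml.
      rewrite exchange_big /= linear_sum -big_split /=.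
      by apply: eq_bigr => j _; have [] := Hc j.
    have -> : y - (T z + \sum_i d i *: e i) = (y - \sum_(j < n) b j) +
        (T (\sum_(j < n) x j - z) + \sum_i (\sum_(j < n) c j i - d i) *: e i).
      rewrite linearB sumb.
      under [X in _ = _ + (_ + X)]eq_bigr do rewrite scalerBl.
      by rewrite sumrB [X in _ = _ + X]addrACA -opprD addrA subrK.
    rewrite (le_trans (rnormD _ _)) // /W 2!mulrDl -addrA lerD //.
    rewrite (le_trans (rnormD _ _)) // lerD //.
    * rewrite (le_trans (TM _)) // -mulrA ler_wpM2l // rnormB; exact: Hz.
    * rewrite (le_trans (rnorm_sum _)) // mulr_suml ler_sum // => i _.
      rewrite rnormZ -mulrA [rnorm (e i) * _]mulrC mulrA ler_wpM2r ?rnorm_ge0 //.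
      by rewrite -[_ - _]/((_ : R[i]^o) - (d i : R[i]^o)) rnormB; exact: Hd.
Qed.

(** By the open mapping theorem the coordinates along [e], which are well defined
    on [F], are continuous; [T @` F] is where they vanish. *)
Lemma closed_image_finite_codim (F : set X) k (e : 'I_k -> X) :
  is_subspace F -> closed F -> T @` F `<=` F -> basis_mod F (T @` F) e ->
  closed (T @` F).
Proof.
move=> sF cF TF [Fe fe se]; have sTF := subspace_image T sF.
have [C C0 HC] := open_mapping sF cF sF cF TF Fe se.
apply/(closed_approx (T @` F)) => y Hy.
have Fy : F y.
  apply: (closed_approx F).1 => // d d0.
  by have [a TFa ya] := Hy d d0; exists a => //; exact: TF.
(* For [a] in [T @` F] the vectors [y] and [y - a] have the same coordinates
   along [e], and those of [y - a] are at most [C] times the distance from [y]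
   to [a], which is arbitrarily small. *)
have [c TFc] := se y Fy.
have c0 i : c i = 0.
  apply: (@rnorm_small_eq _ R[i]^o) => d d0; rewrite subr0.
  have d'0 : 0 < d / (C + 1) by rewrite divr_gt0 //; lra.
  have [a TFa ya] := Hy _ d'0.
  have Fya : F (y - a) by apply: subspace_sub => //; exact: TF.
  have [x [c' [Fx _ c'd yax]]] := HC _ _ Fya d'0 (ltW ya).
  have -> : c i = c' i.
    apply/eqP; rewrite -subr_eq0; apply/eqP.
    apply: (fe (fun i => c i - c' i)).
    under eq_bigr do rewrite scalerBl.
    rewrite sumrB.
    have -> : \sum_i c i *: e i - \sum_i c' i *: e i =
        (a + T x) - (y - \sum_i c i *: e i).
      rewrite opprB addrCA; congr (_ + _).
      have -> : y = a + (T x + \sum_i c' i *: e i) by rewrite -yax addrC subrK.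
      by rewrite addrA opprD addrA subrr add0r.
    apply: subspace_sub => //; apply: subspace_add => //; exact: imageP.
  apply: le_lt_trans (c'd i) _.
  rewrite mulrCA gtr_pMr // ltr_pdivrMr; lra.
by move: TFc; rewrite big1 ?subr0 // => i _; rewrite c0 scale0r.
Qed.

(** Let [y = T x] be a limit of vectors [T a] with [a] in [G]. Lifting
    [y - T a] to a small vector [z] of [F] puts [x - z - a] in the kernel, hence
    [x - z] in [G], and [x - z] is close to [x]. *)
Lemma closed_image_sub (F G : set X) :
  is_subspace F -> closed F -> closed (T @` F) -> is_subspace G -> closed G ->
  G `<=` F -> (forall x, F x -> T x = 0 -> G x) -> closed (T @` G).
Proof.
move=> sF cF cTF sG cG GF kerG; have sTF := subspace_image T sF.
have [//|[//]|y [x Fx <-]|C C0 HC] :=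
    open_mapping (e := fun _ : 'I_0 => 0) sF cF sTF cTF.
  by exists (fun=> 0); rewrite big_ord0 subr0; exists x.
apply/(closed_approx (T @` G)) => y Hy.
have [x Fx Tx] : (T @` F) y.
  apply: (closed_approx (T @` F)).1 => // d d0.
  by have [_ [a /GF Fa <-] ya] := Hy d d0; exists (T a) => //; exists a.
exists x => //; apply: (closed_approx G).1 => // d d0.
have d'0 : 0 < d / (C + 1) by rewrite divr_gt0 //; lra.
have [_ [a Ga <-] ya] := Hy _ d'0.
have TFya : (T @` F) (y - T a).
  by rewrite -Tx -linearB; apply: imageP; apply: subspace_sub => //; exact: GF.
have [z [c [Fz zd _ yz]]] := HC _ _ TFya d'0 (ltW ya).
exists (x - z).
  rewrite -(subrK a (x - z)); apply: subspace_add => //; apply: kerG.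
    by apply: subspace_sub => //; [exact: subspace_sub|exact: GF].
  rewrite !linearB /= Tx addrAC yz big_ord0 addr0; exact: subrr.
rewrite subKr; apply: le_lt_trans zd _.
rewrite mulrCA gtr_pMr // ltr_pdivrMr; lra.
Qed.

(** If [e] is outside [F], at distance [d] from it, the coefficient of [e] in a
    vector of [F + R[i] e] is bounded by [1 / d] times the norm; so when vectors of
    [F + R[i] e] converge their coefficients do, as the scalar field is complete. *)
Lemma closed_add_line (F : set X) (e : X) : is_subspace F -> closed F ->
  closed [set y | exists c : R[i], F (y - c *: e)].
Proof.
move=> sF cF; have [Fe|nFe] := pselect (F e).
  suff -> : [set y | exists c : R[i], F (y - c *: e)] = F by [].
  apply/seteqP; split=> [y [c Fy]|y Fy]; last by exists 0; rewrite scale0r subr0.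
  by rewrite -(subrK (c *: e) y); apply: subspace_add => //; exact: subspace_scale.
have [d d0 Hd] : exists2 d, 0 < d & forall f, F f -> d <= rnorm (e - f).
  apply: contrapT => nd; apply: nFe; apply: (closed_approx F).1 => // d d0.
  apply: contrapT => nf; apply: nd; exists d => // f Ff.
  by rewrite leNgt; apply/negP => fd; apply: nf; exists f.
have coord z (c : R[i]) : F (z - c *: e) ->
    @rnorm R R[i]^o c <= rnorm z / d.
  move=> Fz; rewrite ler_pdivlMr //.
  have [->|c0] := eqVneq c 0.
    by rewrite (@rnorm0 R R[i]^o) mul0r rnorm_ge0.
  have Fe : F (- (c^-1 *: (z - c *: e))).
    by apply: subspace_opp => //; exact: subspace_scale.
  have := Hd _ Fe; rewrite opprK scalerBr scalerA mulVf // scale1r addrC subrK.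
  set w := c^-1 *: z => dw.
  have -> : z = c *: w by rewrite scalerA mulfV // scale1r.
  by rewrite rnormZ ler_wpM2l // rnorm_ge0.
(* [zc k] consists of a vector of [F + R[i] e] and its coefficient along [e] *)
apply/closed_approx => y Hy.
have /choice[zc Hzc] : forall k, exists zc : X * R[i],
    F (zc.1 - zc.2 *: e) /\ rnorm (y - zc.1) < 2^-1 ^+ k.
  move=> k; have k0 : 0 < 2^-1 ^+ k :> R by rewrite exprn_gt0 // invr_gt0.
  by have [z [c Fz] yz] := Hy _ k0; exists (z, c).
have [c Hc] : exists c : R[i]^o, forall k,
    rnorm (c - (zc k).2) <= 2 * (2 / d) * 2^-1 ^+ k.
  apply: (geom_cvg (u := fun k => (zc k).2 : R[i]^o)); first exact: C_complete.
  move=> k; have [F1 y1] := Hzc k.+1; have [F0 y0] := Hzc k.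
  have Fd : F ((zc k.+1).1 - (zc k).1 - ((zc k.+1).2 - (zc k).2) *: e).
    by rewrite scalerBl subrACA; apply: subspace_sub.
  rewrite (le_trans (coord _ _ Fd)) // mulrAC ler_wpM2r ?invr_ge0 ?(ltW d0) //.
  have := rnorm_triangle (zc k.+1).1 y (zc k).1.
  rewrite (rnormB _ y); move: y1; rewrite exprS.
  have : 0 < 2^-1 ^+ k :> R by rewrite exprn_gt0 // invr_gt0.
  by lra.
exists c; apply: (closed_approx F).1 => // eps eps0.
have [k ke] := geometric_small (1 + 2 * (2 / d) * rnorm e) eps0.
have [Fk yk] := Hzc k.
exists ((zc k).1 - (zc k).2 *: e) => //; apply: le_lt_trans ke.
rewrite subrACA -scalerBl (le_trans (rnormD _ _)) // rnormN mulrDl mul1r.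
rewrite lerD //; first exact: ltW.
by rewrite rnormZ mulrAC ler_wpM2r ?rnorm_ge0.
Qed.

Lemma closed_add_span (F : set X) k (e : 'I_k -> X) : is_subspace F -> closed F ->
  closed [set y | exists c : 'I_k -> R[i], F (y - \sum_i c i *: e i)].
Proof.
elim: k F e => [|k IH] F e sF cF.
  suff -> : [set y | exists c : 'I_0 -> R[i], F (y - \sum_i c i *: e i)] = F by [].
  apply/seteqP; split=> [y [c]|y Fy]; last exists (fun=> 0).
    by rewrite big_ord0 subr0.
  by rewrite big_ord0 subr0.
have := IH _ (fun i => e (lift ord0 i)) (is_subspace_add_line (e ord0) sF)
  (closed_add_line (e := e ord0) sF cF).
congr closed; apply/seteqP; split=> y.
  move=> [c [d Fy]].
  exists (fun i => if unlift ord0 i is Some j then c j else d).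
  rewrite big_ord_recl unlift_none; under eq_bigr do rewrite liftK.
  by rewrite opprD addrA addrAC.
move=> [c]; rewrite big_ord_recl opprD addrA addrAC => Fy.
by exists (fun i => c (lift ord0 i)), (c ord0).
Qed.

End Operator.

(** * Restrictions to the ranges of the powers *)

Lemma bounded_rnorm {R : realType} {X : normedModType R[i]}
    (T : {linear X -> X}) : bounded_operator T ->
  exists2 M : R, 0 <= M & forall x, rnorm (T x) <= M * rnorm x.
Proof.
move=> [M HM]; exists (@rnorm R R[i]^o M); first exact: rnorm_ge0.
move=> x; rewrite -lecR rmorphM /= -!rnormE.
rewrite -[X in _ * X]normr_id -[_ * _]normrM ger0_norm //.
exact: le_trans (normr_ge0 _) (HM x).
Qed.

Section Powers.
Context {K : numFieldType} {X : normedModType K} (T : {linear X -> X}).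

Lemma range_op_powerS n : range (op_power T n.+1) = T @` range (op_power T n).
Proof.
apply/seteqP; split=> [_ [x _ <-]|_ [_ [x _ <-] <-]].
  by exists (op_power T n x) => //; exists x.
by exists x.
Qed.

Lemma is_subspace_range n : is_subspace (range (op_power T n)).
Proof.
by apply: (@subspace_image K X X (op_power T n)); split.
Qed.

Lemma range_op_power_stable n :
  T @` range (op_power T n) `<=` range (op_power T n).
Proof.
move=> _ [_ [x _ <-] <-]; exists (T x) => //.
by rewrite /op_power -iterSr.
Qed.

Let val_n n : {linear range_type (op_power T n) -> X} := val.

(** The restriction of [T] acts on a subtype of [X]; the next lemmas express its
    kernel, its range and their dimensions by subspaces of [X]. *)
Lemma image_val n (A : set X) : val_n n @` (val_n n @^-1` A) = range (op_power T n) `&` A.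
Proof.
apply/seteqP; split=> [_ [x Ax <-]|x [Rx Ax]].
  by split=> //; exact: set_mem (range_valP x).
by exists (RangeType (mem_set Rx)).
Qed.

Lemma range_restriction n :
  range (restriction T n) = val_n n @^-1` (T @` range (op_power T n)).
Proof.
apply/seteqP; split=> [_ [x _ <-]|y [x Rx Tx]].
  by exists (val x) => //; exact: set_mem (range_valP x).
by exists (RangeType (mem_set Rx)) => //; apply: val_inj.
Qed.

Lemma lin_dim_null_restriction n : lin_dim (null_space (restriction T n)) =
  dim_mod (range (op_power T n) `&` T @^-1` [set 0]) [set 0].
Proof.
have -> : null_space (restriction T n) = val_n n @^-1` (T @^-1` [set 0]).
  apply/seteqP; split=> x; first by move/(congr1 val).
  by move=> h; apply: val_inj.
rewrite -image_val dim_mod_image.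
- congr dim_mod; apply/seteqP; split=> x; first by move->.
  by move=> h; apply: val_inj.
- apply: subspace_preimage; apply: subspace_preimage; exact: subspace_trivial.
- exact: subspace_trivial.
Qed.

Lemma lin_codim_range_restriction n : lin_codim (range (restriction T n)) =
  dim_mod (range (op_power T n)) (range (op_power T n.+1)).
Proof.
rewrite range_op_powerS /lin_codim range_restriction -dim_mod_image.
- by have := image_val n setT; rewrite setIT preimage_setT => ->.
- by split.
- by apply: subspace_image; exact: is_subspace_range.
Qed.

End Powers.

(** Closedness in [R(T^n)] and in [X] agree for the range of the restriction,
    as [R(T^n)] is itself closed. *)
Lemma closed_range_restriction {R : realType} {X : normedModType R[i]}
    (T : {linear X -> X}) n : closed (range (op_power T n)) ->
  closed (range (restriction T n)) <-> closed (range (op_power T n.+1)).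
Proof.
move=> cR; rewrite range_restriction range_op_powerS.
split=> /closed_approx cTR; apply/closed_approx => y Hy.
- have Ry : range (op_power T n) y.
    apply: (closed_approx _).1 cR _ _ => e e0.
    have [a Ta ya] := Hy e e0; exists a => //.
    exact: range_op_power_stable.
  apply: (cTR (RangeType (mem_set Ry))) => e e0.
  have [a Ta ya] := Hy e e0.
  have Ra := range_op_power_stable Ta.
  by exists (RangeType (mem_set Ra)).
- apply: cTR => e e0; have [a Ta ya] := Hy e e0.
  by exists (val a).
Qed.

(** The finiteness assumption excludes [+oo - +oo], whose value is [-oo]. *)
Lemma sube_cancel_shift (a b d : \bar int) :
  (0 <= a -> 0 <= b -> 0 <= d -> d + a < +oo \/ b + d < +oo ->
  a - b = (d + a) - (b + d))%E.
Proof.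
case: a b d => [a| |] [b| |] [d| |] //= _ _ _; try by case.
by move=> _; rewrite -!EFinD; congr (_%:E); lia.
Qed.

Section Step.
Context {R : realType} {X : completeNormedModType R[i]} (T : {linear X -> X}).
Hypothesis bT : bounded_operator T.

Lemma semi_Fredholm_step n :
  closed (range (op_power T n)) -> semi_Fredholm (restriction T n) ->
  [/\ closed (range (op_power T n.+1)), semi_Fredholm (restriction T n.+1) &
      fredholm_index (restriction T n.+1) = fredholm_index (restriction T n)].
Proof.
have cX : cauchy_complete X by move=> F PF; exact: cauchy_cvg.
have [M M0 TM] := bounded_rnorm bT.
move=> cR; rewrite /semi_Fredholm /upper_semi_Fredholm /lower_semi_Fredholm /fredholm_index.
rewrite !lin_dim_null_restriction !lin_codim_range_restriction => sf.
have sR := is_subspace_range T n; have TR := @range_op_power_stable _ _ T n.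
have [d d0 []] := dim_restriction_shift sR TR.
rewrite -!range_op_powerS => aE bE.
have cR1 : closed (range (op_power T n.+1)).
  case: sf => [[cTR _]|/dim_mod_finP[k [e be]]].
    exact/closed_range_restriction.
  rewrite range_op_powerS in be *.
  exact: (closed_image_finite_codim cX M0 TM sR cR TR be).
split=> //.
  case: sf => [[_ afin]|bfin]; last first.
    by right; move: bfin; rewrite bE; apply: le_lt_trans; rewrite leeDl.
  left; split; last first.
    by move: afin; rewrite aE; apply: le_lt_trans; rewrite leeDr.
  apply/closed_range_restriction => //; rewrite range_op_powerS.
  have /dim_mod_finP[k [e [Ne fe se]]] := afin.
  (* [G] is [R(T^n.+1)] plus the kernel of [T] on [R(T^n)]: it has the same image
     as [R(T^n.+1)], but contains that kernel *)
  pose G := [set y | exists c : 'I_k -> R[i], range (op_power T n.+1) (y - \sum_i c i *: e i)].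
  have -> : T @` range (op_power T n.+1) = T @` G.
    apply/seteqP; split=> [_ [x Rx <-]|_ [x [c Rx] <-]].
      exists x => //; exists (fun=> 0).
      by rewrite big1 ?subr0 // => i _; rewrite scale0r.
    exists (x - \sum_i c i *: e i) => //.
    rewrite linearB linear_sum big1 ?subr0 // => i _.
    by have [_ /= Te] := Ne i; rewrite linearZ /= Te scaler0.
  have sub1 : range (op_power T n.+1) `<=` range (op_power T n).
    by rewrite range_op_powerS.
  have sG : is_subspace G by apply: is_subspace_add_span; exact: is_subspace_range.
  apply: (closed_image_sub cX M0 TM sR cR) => //.
  - by rewrite -range_op_powerS.
  - exact: closed_add_span (is_subspace_range _ _) cR1.
  - move=> x [c Rx]; rewrite -(subrK (\sum_i c i *: e i) x).
    apply: subspace_add => //; first exact: sub1.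
    by apply: subspace_sum => // i; have [] := Ne i.
  - move=> x Rx Tx; have [c xc] := se x (conj Rx Tx).
    by exists c; rewrite xc; case: (is_subspace_range T n.+1).
rewrite aE bE; apply: sube_cancel_shift; rewrite ?dim_mod_ge0 //.
by rewrite -aE -bE; case: sf => [[_]|]; [left|right].
Qed.

End Step.

Theorem proposition2p12 (R : realType) (X : completeNormedModType R[i])
    (T : {linear X -> X}) :
  lin_dim [set: X] = +oo%E ->
  bounded_operator T ->
  forall n : nat,
    closed (range (op_power T n)) ->
    semi_Fredholm (restriction T n) ->
    forall m : nat, (n <= m)%N ->
      [/\ closed (range (op_power T m)),
          semi_Fredholm (restriction T m) &
          fredholm_index (restriction T m) = fredholm_index (restriction T n)].
Proof.
move=> _ bT n cRn sfn m /subnKC <-.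
elim: (m - n)%N => [|k [cR sf <-]]; first by rewrite addn0.
by rewrite addnS; exact: semi_Fredholm_step.
Qed.
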